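(* Let $q\ge 2$ and $k\ge 1$ be integers, and let $$a(n)=\sum_{i=0}^{T_q(n)-k}P(\epsilon_{i+k}(n),\dots,\epsilon_i(n)),$$ where $\epsilon_0(n),\dots,\epsilon_{T_q(n)}(n)$ are the base-$q$ digits of $n$ and $P\in\mathbb{Z}[X_k,\dots,X_0]$ is a polynomial of degree $d\le k+1$ of the form $$P(X_k,\dots,X_0)=X_kX_0P_1(X_k,\dots,X_0)+P_2(X_k,\dots,X_0),$$ where $P_1,P_2\in\mathbb{Z}[X_k,\dots,X_0]$ are such that the equation $P_1(1,X_{k-1},\dots,X_1,1)=1$ has a solution $(X_{k-1},\dots,X_1)\in\{0,1,\dots,q-1\}^{k-1}$, and $P_2$ has no nonzero monomial divisible by $X_kX_0$. Then $$\lim_{N\to\infty}\frac1N\sum_{n\le N}\mu(n)(-1)^{a(n)}=0.$$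
   Context: $\mu$ is the Möbius function. Every integer $n\ge 1$ is written in base $q$ as $n=\sum_{i\ge0}\epsilon_i(n)q^i$ with $\epsilon_i(n)\in\{0,\dots,q-1\}$, and $T_q(n)=\lfloor \log n/\log q\rfloor$, so that $\epsilon_{T_q(n)}(n)$ is the leading nonzero digit of $n$. An empty sum (when $T_q(n)<k$) equals $0$. *)

(* Defs.v *)
(* The notations of mpoly clash with those of MathComp-Analysis, hence they are
   not imported. *)
From HB Require Import structures.
From mathcomp Require Import all_boot all_order all_algebra.
From mathcomp Require Import -(notations) mpoly.
From mathcomp Require Import reals topology normedtype exp.

Set Implicit Arguments.
Unset Strict Implicit.
Unset Printing Implicit Defensive.

Import Order.TTheory GRing.Theory Num.Theory.

Local Open Scope ring_scope.

(* The value at n = 0 is a convention, never used below. *)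
Definition mobius (n : nat) : int :=
  if (0 < n)%N && all (fun p => logn p n == 1%N) (primes n)
  then (-1) ^+ size (primes n) else 0.

Definition digit (q i n : nat) : nat := ((n %/ q ^ i) %% q)%N.

(* T_q(n); trunc_log q n is the largest e with q ^ e <= n. *)
Definition topdigit (q n : nat) : nat := trunc_log q n.

Lemma topdigitE (R : realType) (q n : nat) : (1 < q)%N -> (0 < n)%N ->
  (topdigit q n)%:Z = Num.floor (ln n%:R / ln q%:R :> R).
Proof.
move=> q1 n0; have q0 : (0 < q)%N by exact: ltnW.
have lnq : 0 < ln q%:R :> R by rewrite ln_gt0 // ltr1n.
have qXpos m : ((q ^ m)%:R : R) \in Num.pos by rewrite posrE ltr0n expn_gt0 q0.
have npos : (n%:R : R) \in Num.pos by rewrite posrE ltr0n.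
have lnqX m : ln (q ^ m)%:R = m%:R * ln q%:R :> R.
  by rewrite natrX lnXn ?ltr0n // mulr_natl.
have /andP[lo hi] := trunc_log_bounds q1 n0.
apply/esym/floor_def; rewrite intrD -!pmulrn natr1.
rewrite ler_pdivlMr // ltr_pdivrMr // -!lnqX ler_ln ?qXpos //.
rewrite ltr_ln ?qXpos //.
by rewrite ler_nat ltr_nat lo hi.
Qed.

Lemma digit_expansion (q n : nat) : (1 < q)%N ->
  n = (\sum_(i < (topdigit q n).+1) digit q i n * q ^ i)%N.
Proof.
move=> q1.
have H m : (\sum_(i < m) digit q i n * q ^ i = n %% q ^ m)%N.
  elim: m => [|m IHm]; first by rewrite big_ord0 expn0 modn1.
  rewrite big_ord_recr /= IHm /digit; have q0 : (0 < q)%N by exact: ltnW.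
  have qm0 : (0 < q ^ m)%N by rewrite expn_gt0 q0.
  set d := (n %/ q ^ m %% q)%N; set r := (n %% q ^ m)%N.
  have nE : n = ((n %/ q ^ m %/ q) * q ^ m.+1 + (r + d * q ^ m))%N.
    rewrite {1}(divn_eq n (q ^ m)) {1}(divn_eq (n %/ q ^ m) q).
    by rewrite mulnDl -mulnA -expnS -addnA [(r + _)%N]addnC.
  rewrite [in RHS]nE modnMDl modn_small //.
  have h1 : (d < q)%N by rewrite ltn_mod.
  apply: (@leq_trans (d.+1 * q ^ m)).
    by rewrite mulSn ltn_add2r ltn_mod.
  by rewrite expnS leq_mul2r h1 orbT.
by rewrite H modn_small // trunc_log_ltn.
Qed.

(* a(n). The variable X_j of the polynomial is the one of index j : 'I_k.+1.
   The range 0 <= i <= T_q(n) - k has (T_q(n) + 1 - k) elements when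
   k <= T_q(n); otherwise the truncated subtraction yields the empty sum. *)
Definition block_sum (q k : nat) (P : mpoly k.+1 int) (n : nat) : int :=
  \sum_(i < (topdigit q n).+1 - k)
    meval (fun j : 'I_k.+1 => (digit q (i + j) n)%:Z) P.

(* Main.v *)
Require Import Defs.
From HB Require Import structures.
From mathcomp Require Import all_boot all_order all_algebra.
From mathcomp Require Import -(notations) mpoly.
From mathcomp Require Import classical_sets reals topology normedtype.
From mathcomp Require Import zify ring lra.
Import Order.TTheory GRing.Theory Num.Theory.
Import numFieldNormedType.Exports.
Local Open Scope classical_set_scope.
Local Open Scope ring_scope.
Set Implicit Arguments.
Unset Strict Implicit.
Unset Printing Implicit Defensive.

(** Write f(n) = (-1)^a(n). By the Katai (Bourgain-Sarnak-Ziegler) criterion,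
    which rests on the Turan-Kubilius inequality and the divergence of the sum of
    1/p, it suffices that for distinct primes p, r > q^k the sum over n <= N of
    g(n) = f(p n) f(r n) is o(N).

    Suppose that two blocks u, v of D digits are such that replacing u by v at any
    D consecutive digits of n flips the sign of g(n). Cutting n into J blocks of D
    digits, the n having some block in {u, v} cancel in pairs, and only the
    proportion (1 - 2/q^D)^J of the others remains.

    Padding u and v by zeros isolates them from carries and from neighbouring
    windows, so it is enough that n |-> a(p n) + a(r n) is not constant modulo 2, a
    being computed with leading and trailing zeros. This is seen on the four numbers
    n_st = x + s + q^(j+k) t y with s, t in {0, 1}: for a suitable x the digits of
    r n_st in positions j, ..., j+k are s, c_1, ..., c_(k-1), t, where c is the given
    solution of P1(1, c, 1) = 1, while no window of p n_st depends on both s and t.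
    The second difference in (s, t) of a(p n) + a(r n) is then P1(1, c, 1) = 1. *)

(** * The sum of the reciprocals of the primes *)

Lemma big_dvdn (T : Type) (idx : T) (op : Monoid.com_law idx) (d N : nat)
    (F : nat -> T) : (0 < d)%N ->
  \big[op/idx]_(1 <= n < N.+1 | (d %| n)%N) F n
    = \big[op/idx]_(1 <= m < (N %/ d).+1) F (d * m)%N.
Proof.
move=> d0; elim: N => [|N IHN]; first by rewrite div0n !big_geq.
rewrite big_mkcond big_nat_recr //= -big_mkcond IHN divnS //.
case: ifP => [dN|_]; last by rewrite Monoid.mulm1 add0n.
rewrite add1n [RHS]big_nat_recr //=; congr (op _ (F _)).
by rewrite -[LHS](divnK dN) divnS // dN add1n mulnC.
Qed.

Lemma square_squarefree_decomp (n : nat) : (0 < n)%N ->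
  exists b c, [/\ (0 < b)%N, n = (b ^ 2 * c)%N
                & forall p, (logn p c <= 1)%N].
Proof.
elim/ltn_ind: n => n IHn n0.
have [/existsP[p p2]|no] := boolP [exists p : 'I_n.+1, 1 < logn p n]%N; last first.
  exists 1%N, n; split=> // [|p]; first by rewrite exp1n mul1n.
  have [pn|np] := ltnP p n.+1; last first.
    by rewrite lognE; case: and3P => // -[_ _ /dvdn_leq]; lia.
  by move: no; rewrite negb_exists => /forallP /(_ (Ordinal pn)) /=; rewrite -leqNgt.
have p2n : (p ^ 2 %| n)%N.
  by rewrite (dvdn_trans _ (pfactor_dvdnn p n)) // dvdn_exp2l.
have p_pr : prime p by move: p2; rewrite lognE; case: prime.
have p1 := prime_gt1 p_pr.
have p0 := prime_gt0 p_pr.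
have p20 : (0 < p ^ 2)%N by rewrite expn_gt0 p0.
have n'0 : (0 < n %/ p ^ 2)%N by rewrite divn_gt0 // dvdn_leq.
have [|b [c [b0 nE c1]]] := IHn (n %/ p ^ 2)%N _ n'0.
  by rewrite ltn_Pdiv // -(exp1n 2) ltn_exp2r.
exists (p * b)%N, c; split=> //; first by rewrite muln_gt0 p0.
by rewrite -[LHS](divnK p2n) nE expnMn mulnC mulnA.
Qed.

(** Makes a squarefree number with prime factors at most M recoverable from a subset of ['I_M.+1],
    which is how such numbers are counted. *)
Lemma squarefree_prod (M c : nat) : (0 < c)%N -> (forall p, logn p c <= 1)%N ->
    (forall p, p \in primes c -> (p <= M)%N) ->
  c = (\prod_(i < M.+1 | (i : nat) \in primes c) i)%N.
Proof.
move=> c0 c1 cM.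
rewrite -(big_mkord (fun i => i \in primes c) id) -big_filter.
rewrite {1}(prod_prime_decomp c0) prime_decompE big_map /=.
rewrite (@perm_big _ _ _ _ [seq i <- index_iota 0 M.+1 | i \in primes c]
           (primes c)); last first.
  apply: uniq_perm; rewrite ?filter_uniq ?iota_uniq ?primes_uniq // => p.
  rewrite mem_filter mem_index_iota /= ltnS; apply/andP/idP => [[]//|pc].
  by rewrite pc cM.
rewrite !big_seq; apply: eq_bigr => p pc.
suff -> : logn p c = 1%N by rewrite expn1.
by apply/eqP; rewrite eqn_leq c1 logn_gt0.
Qed.

(** Erdos's count: n = b^2 c with c squarefree is determined by b <= 2^L and by the set of primes
    dividing c. *)
Lemma card_smooth (M L : nat) :
  (\sum_(1 <= n < (4 ^ L).+1 | all (leq^~ M) (primes n)) 1 <= 2 ^ (M.+1 + L))%N.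
Proof.
rewrite (@big_nat_widenl _ _ _ _ 0%N) // big_mkord sum1_card.
(* [x.2.+1] because b >= 1. Values beyond 4^L fall on the default of [inord], harmlessly: only the
   smooth n have to be reached. *)
pose h (x : {set 'I_M.+1} * 'I_(2 ^ L)) : 'I_(4 ^ L).+1 :=
  inord (x.2.+1 ^ 2 * \prod_(i in x.1) i).
have <- : #|{: {set 'I_M.+1} * 'I_(2 ^ L)}| = (2 ^ (M.+1 + L))%N.
  by rewrite card_prod card_ord -cardsT -powersetT card_powerset cardsT card_ord expnD.
apply: leq_trans (leq_image_card h _); apply/subset_leq_card/fintype.subsetP => n.
rewrite unfold_in /= => /andP[/allP sm n0].
have [b [c [b0 nE c1]]] := square_squarefree_decomp n0.
have c0 : (0 < c)%N by move: n0; rewrite nE; case: c {nE c1} => //; rewrite muln0.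
have cM p : p \in primes c -> (p <= M)%N.
  move=> pc; apply: sm; move: pc; rewrite !mem_primes c0 n0 => /and3P[-> _ pc] /=.
  by rewrite nE dvdn_mull.
have bL : (b.-1 < 2 ^ L)%N.
  rewrite prednK // -(@leq_exp2r _ _ 2) // -expnM mulnC expnM -ltnS.
  by apply: leq_trans (ltn_ord n); rewrite ltnS nE leq_pmulr.
apply/fintype.imageP.
exists ([set i : 'I_M.+1 | (i : nat) \in primes c]%SET, Ordinal bL) => //.
apply/val_inj; rewrite /h /= prednK //.
under eq_bigl do rewrite inE.
by rewrite -squarefree_prod // -nE inordK.
Qed.

(** At most half of the n <= N = 4^(M+2) are M-smooth; each of the others has a prime factor in [s],
    so N / 2 is at most the sum of the N / p. *)
Lemma sum_inv_primes_half (R : realFieldType) (M : nat) :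
  1 / 2 <= \sum_(p <- [seq p <- iota M.+1 (4 ^ M.+2) | prime p]) p%:R^-1 :> R.
Proof.
set s := [seq p <- _ | prime p]; set N := (4 ^ M.+2)%N.
have N0 : (0 < N)%N by rewrite expn_gt0.
have main : (N <= 2 ^ (M.+1 + M.+2) + \sum_(p <- s) N %/ p)%N.
  have -> : (\sum_(p <- s) N %/ p = \sum_(1 <= n < N.+1) \sum_(p <- s) (p %| n))%N.
    rewrite exchange_big /= !big_seq; apply: eq_bigr => p.
    rewrite mem_filter => /andP[/prime_gt0 p0 _].
    rewrite -big_mkcond /= big_dvdn //.
    by rewrite sum_nat_const_nat muln1 subSS subn0.
  apply: leq_trans (leq_add (card_smooth M M.+2) (leqnn _)).
  rewrite [X in (_ <= X + _)%N]big_mkcond -big_split /=.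
  rewrite -[leqLHS]muln1 -[X in (X * 1)%N](subn0 N) -subSS -sum_nat_const_nat.
  rewrite !big_nat; apply: leq_sum => n /andP[n0 nN].
  case: ifP => [//|/negbT/allPn[p]].
  rewrite mem_primes -ltnNge => /and3P[p_pr _ pn] Mp.
  rewrite (big_rem p) /= ?pn //.
  rewrite mem_filter p_pr mem_iota Mp /=; move: (dvdn_leq n0 pn) nN.
  by rewrite -/N; lia.
have twice : (2 * 2 ^ (M.+1 + M.+2) = N)%N.
  by rewrite -expnS /N -(expnM 2 2); congr (_ ^ _)%N; lia.
have : N%:R <= 2 * \sum_(p <- s) (N %/ p)%:R :> R.
  by rewrite -natr_sum -natrM ler_nat; lia.
have : \sum_(p <- s) (N %/ p)%:R <= N%:R * \sum_(p <- s) p%:R^-1 :> R.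
  rewrite mulr_sumr !big_seq; apply: ler_sum => p.
  rewrite mem_filter => /andP[/prime_gt0 p0 _].
  by rewrite ler_pdivlMr ?ltr0n // -natrM ler_nat leq_trunc_div.
move=> h1 h2; have h3 := le_trans h2 (ler_wpM2l (ler0n _ 2) h1).
rewrite ler_pdivrMr ?ltr0n //; move: h3.
by rewrite mulrCA -[X in X <= _]mulr1 ler_pM2l ?ltr0n // mulrC.
Qed.

Lemma sum_inv_primes_unbounded (R : realFieldType) (M B : nat) :
  exists s : seq nat, [/\ uniq s, forall p, p \in s -> prime p && (M < p)%N
    & B%:R <= \sum_(p <- s) p%:R^-1 :> R].
Proof.
suff [s [us sP sB]] : exists s : seq nat,
    [/\ uniq s, forall p, p \in s -> prime p && (M < p)%N
      & B.*2%:R / 2 <= \sum_(p <- s) p%:R^-1 :> R].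
  by exists s; split=> //; apply: le_trans sB; rewrite -muln2 natrM mulfK ?pnatr_eq0.
elim: B.*2 => [|C [s [us sP sB]]].
  by exists [::]; split=> //; rewrite big_nil mul0r.
(* Starting beyond all primes chosen so far keeps the blocks disjoint; each adds 1/2, hence the 2 B
   steps. *)
pose L := \max_(p <- s) p; pose M' := maxn M L.
exists (s ++ [seq p <- iota M'.+1 (4 ^ M'.+2) | prime p]); split.
- rewrite cat_uniq us filter_uniq ?iota_uniq // andbT; apply/hasPn => p.
  rewrite mem_filter mem_iota => /andP[_ /andP[pM _]]; apply/negP => ps.
  have := @leq_bigmax_seq _ s xpredT id p ps isT.
  by move: pM; rewrite -/L /M'; lia.
- move=> p; rewrite mem_cat => /orP[/sP//|].
  by rewrite mem_filter mem_iota => /andP[-> /andP[pM _]]; move: pM; rewrite /M'; lia.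
- by rewrite big_cat -natr1 mulrDl lerD // sum_inv_primes_half.
Qed.

(** * Katai's criterion *)

Lemma mobius_norm_le1 (R : realDomainType) (n : nat) : `|(mobius n)%:~R : R| <= 1.
Proof.
rewrite /mobius; case: ifP => _; last by rewrite normr0.
by rewrite rmorphXn rmorphN1 normrX normrN1 expr1n.
Qed.

Lemma mobius_prime_mul (p m : nat) : prime p -> (0 < m)%N -> ~~ (p %| m)%N ->
  mobius (p * m) = - mobius m.
Proof.
move=> p_pr m0 pm; have p0 := prime_gt0 p_pr.
have primes_pm : perm_eq (primes (p * m)) (p :: primes m).
  apply: uniq_perm; rewrite /= ?primes_uniq ?andbT //.
    by rewrite mem_primes (negPf pm) !andbF.
  by move=> r; rewrite primesM // inE primes_prime // inE.
rewrite /mobius m0 muln_gt0 p0 m0 /= (perm_all _ primes_pm) (perm_size primes_pm) /=.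
have -> : logn p (p * m) == 1%N.
  by rewrite lognM // logn_prime // eqxx lognE (negPf pm) !andbF.
have -> : all (fun r => logn r (p * m) == 1%N) (primes m)
        = all (fun r => logn r m == 1%N) (primes m).
  apply: eq_in_all => r; rewrite mem_primes => /and3P[r_pr _ rm].
  rewrite lognM // logn_prime //; case: (eqVneq r p) => [rp|//].
  by move: pm; rewrite -rp rm.
by case: (all _ _); rewrite ?oppr0 // exprS mulN1r.
Qed.

(** u(N) = o(N), in a division-free form that needs no topology on the field. *)
Definition small_o (R : numDomainType) (u : nat -> R) : Prop :=
  forall e : R, 0 < e -> exists N0 : nat, forall N, (N0 <= N)%N -> `|u N| <= e * N%:R.

Lemma small_oD (R : realFieldType) (u v : nat -> R) :
  small_o u -> small_o v -> small_o (fun N => u N + v N).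
Proof.
move=> hu hv e e0; have e20 : 0 < e / 2 by rewrite divr_gt0.
have [Nu Hu] := hu _ e20; have [Nv Hv] := hv _ e20.
exists (maxn Nu Nv) => N; rewrite geq_max => /andP[/Hu lu /Hv lv].
apply: le_trans (ler_normD _ _) _; apply: le_trans (lerD lu lv) _.
by rewrite -mulrDl -splitr.
Qed.

Lemma small_o_sum (R : realFieldType) (I : eqType) (r : seq I) (P : pred I)
    (u : I -> nat -> R) : (forall i, i \in r -> P i -> small_o (u i)) ->
  small_o (fun N => \sum_(i <- r | P i) u i N).
Proof.
elim: r => [|i r IHr] hu e e0.
  by exists 0%N => N _; rewrite big_nil normr0 mulr_ge0 // ltW.
have hr : small_o (fun N => \sum_(j <- r | P j) u j N).
  by apply: IHr => j jr; apply: hu; rewrite inE jr orbT.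
have [Pi|nPi] := boolP (P i).
  have [N0 HN0] := small_oD (hu i (mem_head _ _) Pi) hr e0.
  by exists N0 => N /HN0; rewrite big_cons Pi.
have [N0 HN0] := hr _ e0.
by exists N0 => N /HN0; rewrite big_cons (negPf nPi).
Qed.

Lemma small_o_divn (R : realFieldType) (u : nat -> R) (d : nat) : (0 < d)%N ->
  small_o u -> small_o (fun N => u (N %/ d)%N).
Proof.
move=> d0 hu e e0; have [N0 HN0] := hu _ e0.
exists (N0 * d)%N => N; rewrite -leq_divRL // => /HN0 /le_trans; apply.
by rewrite ler_pM2l // ler_nat leq_div.
Qed.

Lemma natr_divn_le (R : realFieldType) (N d : nat) :
  ((N %/ d)%:R : R) <= N%:R / d%:R.
Proof.
case: d => [|d]; first by rewrite divn0 invr0 mulr0.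
by rewrite ler_pdivlMr ?ltr0n // -natrM ler_nat leq_trunc_div.
Qed.

Lemma sum_dvdn_count (R : pzRingType) (N d : nat) : (0 < d)%N ->
  \sum_(1 <= n < N.+1) (d %| n)%:R = (N %/ d)%:R :> R.
Proof.
move=> d0; under eq_bigr => n _ do rewrite mulrb.
rewrite -big_mkcond /= big_dvdn // big_const_nat subSS subn0.
by rewrite iter_addr_0.
Qed.

(** Expand the square, with S the sum of the 1/p: pairs p <> r give at most N / (p r), the diagonal
    N / p, and the cross term is at most -2 S (N S - |s|), so that the terms N S^2 cancel. *)
Lemma turan_kubilius (R : realFieldType) (s : seq nat) (N : nat) :
    uniq s -> (forall p, p \in s -> prime p) ->
  \sum_(1 <= n < N.+1)
      (\sum_(p <- s) (p %| n)%:R - \sum_(p <- s) p%:R^-1) ^+ 2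
    <= (N%:R + 2 * (size s)%:R) * \sum_(p <- s) p%:R^-1 :> R.
Proof.
move=> us sP; set S := \sum_(p <- s) p%:R^-1.
have S0 : 0 <= S by apply: sumr_ge0 => p _; rewrite invr_ge0.
have sum1 : N%:R * S - (size s)%:R
    <= \sum_(1 <= n < N.+1) \sum_(p <- s) (p %| n)%:R.
  rewrite exchange_big /= mulr_sumr -sum1_size natr_sum -sumrB.
  rewrite !big_seq; apply: ler_sum => p /sP/prime_gt0 p0.
  rewrite sum_dvdn_count // lerBlDr natr1 ler_pdivrMr ?ltr0n //.
  by rewrite -natrM ler_nat ltnW // ltn_ceil.
have sum2 : \sum_(1 <= n < N.+1) (\sum_(p <- s) (p %| n)%:R) ^+ 2
    <= N%:R * S ^+ 2 + N%:R * S.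
  have -> : \sum_(1 <= n < N.+1) (\sum_(p <- s) (p %| n)%:R) ^+ 2 =
      \sum_(p <- s) \sum_(r <- s) \sum_(1 <= n < N.+1)
        ((p %| n)%:R * (r %| n)%:R) :> R.
    under eq_bigr => n _ do rewrite expr2 big_distrlr.
    by rewrite exchange_big /=; apply: eq_bigr => p _; rewrite exchange_big.
  rewrite [X in _ * X + _]expr2 {1}mulr_suml !mulr_sumr -big_split /=.
  rewrite big_seq [leRHS]big_seq; apply: ler_sum => p ps.
  have p_pr := sP _ ps; have p0 := prime_gt0 p_pr.
  rewrite (bigD1_seq p) //= addrC lerD //; last first.
    under eq_bigr => n _ do rewrite -natrM mulnb andbb.
    by rewrite sum_dvdn_count // natr_divn_le.
  rewrite mulrA mulr_sumr [leRHS](bigD1_seq p) //=.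
  apply: le_trans (_ : \sum_(r <- s | r != p) N%:R / p%:R / r%:R <= _); last first.
    by rewrite lerDr !divr_ge0.
  rewrite big_seq_cond [leRHS]big_seq_cond; apply: ler_sum => r /andP[rs rp].
  have r_pr := sP _ rs.
  have cpr : coprime p r.
    by rewrite prime_coprime // dvdn_prime2 // eq_sym.
  under eq_bigr => n _ do rewrite -natrM mulnb -Gauss_dvd //.
  rewrite sum_dvdn_count ?muln_gt0 ?p0 ?prime_gt0 //.
  by apply: le_trans (natr_divn_le _ _ _) _; rewrite natrM invfM mulrA.
under eq_bigr => n _ do rewrite sqrrB.
rewrite big_split sumrB /= big_const_nat subSS subn0 iter_addr_0.
rewrite sumrMnl -mulr_suml.
have := ler_wpM2l S0 sum1.
move: sum2; set A := \sum_(_ <= _ < _) _ ^+ 2; set B := \sum_(_ <= _ < _) _.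
rewrite -[S ^+ 2 *+ N]mulr_natl; set n := N%:R; set c := (size s)%:R => h1 h2.
by move: h1 h2; nra.
Qed.

Lemma sum_muln_le (R : nmodType) (d N : nat) (F : nat -> R) : (0 < d)%N ->
  \sum_(1 <= m < N.+1 | (d * m <= N)%N) F m = \sum_(1 <= m < (N %/ d).+1) F m.
Proof.
move=> d0; rewrite (@big_nat_widen _ _ _ 1 (N %/ d).+1 N.+1) ?ltnS ?leq_div //.
by apply: eq_bigl => m; rewrite ltnS leq_divRL // mulnC.
Qed.

(** Termwise 2 |x| <= x^2 / t + t; with t free this replaces Cauchy-Schwarz and avoids square
    roots. *)
Lemma sum_norm_le_sqr (R : realFieldType) (F : nat -> R) (N : nat) (t : R) :
    0 < t ->
  2 * \sum_(1 <= n < N.+1) `|F n| <= (\sum_(1 <= n < N.+1) F n ^+ 2) / t + t * N%:R.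
Proof.
move=> t0; have -> : t * N%:R = \sum_(1 <= n < N.+1) t.
  by rewrite big_const_nat subSS subn0 iter_addr_0 mulr_natr.
rewrite mulr_sumr mulr_suml -big_split /=; apply: ler_sum => n _.
rewrite -(ler_pM2r t0) [leRHS]mulrDl divfK ?gt_eqF // -real_normK ?num_real //.
by have := sqr_ge0 (`|F n| - t); rewrite sqrrB; lra.
Qed.

Definition prime_correlation (R : pzSemiRingType) (f : nat -> R) (p r N : nat) : R :=
  \sum_(1 <= m < N.+1) f (p * m)%N * f (r * m)%N.

(** By Turan-Kubilius, S T is close to X, where n is weighted by its number [w n] of divisors in
    [s]. As g (p m) = - g m for most m, X is close to -Y, and Y is controlled by the second moment
    of [G], that is, by the correlations. *)
Lemma katai_inequality (R : realFieldType) (f g : nat -> R) (s : seq nat)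
    (M N : nat) (t : R) :
    (forall n, `|f n| <= 1) -> (forall n, `|g n| <= 1) ->
    (forall p m, p \in s -> (0 < m)%N -> ~~ (p %| m)%N -> g (p * m)%N = - g m) ->
    uniq s -> (forall p, p \in s -> prime p && (M < p)%N) -> (0 < M)%N -> 0 < t ->
  2 * (\sum_(p <- s) p%:R^-1) * `|\sum_(1 <= n < N.+1) g n * f n| <=
    (2 * (N%:R + (size s)%:R) / t + 4 * N%:R / M%:R) * \sum_(p <- s) p%:R^-1
    + 2 * t * N%:R
    + (\sum_(p <- s) \sum_(r <- s | r != p)
         prime_correlation f p r (N %/ maxn p r)) / t.
Proof.
move=> f1 g1 gM us sP M0 t0; set S := \sum_(p <- s) p%:R^-1.
set T := \sum_(_ <= _ < _) _.
have spr p : p \in s -> prime p by case/sP/andP.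
have sgt0 p : p \in s -> (0 < p)%N by move/spr/prime_gt0.
have S0 : 0 <= S by apply: sumr_ge0 => p _; rewrite invr_ge0.
pose w n : R := \sum_(p <- s) (p %| n)%:R.
pose G m : R := \sum_(p <- s | (p * m <= N)%N) f (p * m)%N.
set Off := \sum_(p <- s) _.
pose X := \sum_(1 <= n < N.+1) g n * f n * w n.
pose Y := \sum_(1 <= m < N.+1) g m * G m.
have X_E : X = \sum_(p <- s) \sum_(1 <= m < (N %/ p).+1) g (p * m)%N * f (p * m)%N.
  rewrite /X; under eq_bigr => n _ do rewrite mulr_sumr.
  rewrite exchange_big /= !big_seq; apply: eq_bigr => p /sgt0 p0.
  rewrite -(big_dvdn _ _ (fun n => g n * f n)) // [RHS]big_mkcond /=.
  by apply: eq_bigr => n _; case: dvdn; rewrite ?mulr1 ?mulr0.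
have Y_E : Y = \sum_(p <- s) \sum_(1 <= m < (N %/ p).+1) g m * f (p * m)%N.
  rewrite /Y; under eq_bigr => n _ do rewrite mulr_sumr big_mkcond.
  rewrite exchange_big /= !big_seq; apply: eq_bigr => p /sgt0 p0.
  by rewrite -big_mkcond sum_muln_le.
(* The terms cancel unless p divides m; this leaves at most N / p^2 <= N / (p M) values of m, each
   costing at most 2. *)
have XY : `|X + Y| <= 2 * N%:R / M%:R * S.
  rewrite X_E Y_E -big_split mulr_sumr /=; apply: le_trans (ler_norm_sum _ _ _) _.
  rewrite big_seq [leRHS]big_seq; apply: ler_sum => p ps.
  have p0 := sgt0 p ps; rewrite -big_split /=.
  apply: (@le_trans _ _ (\sum_(1 <= m < (N %/ p).+1) 2 * (p %| m)%:R)).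
    apply: le_trans (ler_norm_sum _ _ _) _; rewrite big_nat [leRHS]big_nat.
    apply: ler_sum => m /andP[m0 _]; rewrite -mulrDl normrM.
    have [pm|pm] := boolP (p %| m)%N; last first.
      by rewrite gM // addNr normr0 mul0r mulr0.
    rewrite ler_pM //.
      apply: le_trans (ler_normD _ _) _.
      exact: lerD.
  rewrite -mulr_sumr sum_dvdn_count // -mulrA -mulrA ler_pM2l //.
  apply: le_trans (natr_divn_le _ _ _) _.
  rewrite mulrA; apply: ler_wpM2r; rewrite ?invr_ge0 //.
  apply: le_trans (natr_divn_le _ _ _) _.
  apply: ler_wpM2l; rewrite // lef_pV2 ?posrE ?ltr0n // ler_nat ltnW //.
  by case/andP: (sP _ ps).
(* Pairs p = r contribute at most N / p each; the distinct pairs form [Off]. *)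
have G2 : \sum_(1 <= m < N.+1) G m ^+ 2 <= N%:R * S + Off.
  have -> : \sum_(1 <= m < N.+1) G m ^+ 2 = \sum_(p <- s) \sum_(r <- s)
      prime_correlation f p r (N %/ maxn p r).
    under eq_bigr => m _ do
      rewrite /G expr2 !(big_mkcond (fun p => _ <= _)%N) big_distrlr.
    rewrite exchange_big /= !big_seq; apply: eq_bigr => p ps.
    rewrite exchange_big /= !big_seq; apply: eq_bigr => r rs.
    rewrite /prime_correlation -sum_muln_le ?leq_max ?sgt0 // [RHS]big_mkcond /=.
    apply: eq_bigr => m _; rewrite maxnMl geq_max.
    by case: leq; case: leq; rewrite ?mul0r ?mulr0.
  rewrite /Off mulr_sumr -big_split /= !big_seq; apply: ler_sum => p ps.
  rewrite (bigD1_seq p) //= lerD2r maxnn.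
  apply: le_trans (natr_divn_le _ _ _).
  rewrite -[leRHS]mulr1 mulr_natl -[X in _ *+ X](subn0 (N %/ p)%N) -subSS.
  rewrite -sumr_const_nat; apply: ler_sum => m _.
  apply: le_trans (ler_norm _) _; rewrite normrM.
  by rewrite -[leRHS]mulr1 ler_pM.
have W2 : \sum_(1 <= n < N.+1) (w n - S) ^+ 2 <= (N%:R + 2 * (size s)%:R) * S.
  exact: turan_kubilius.
have TE : S * T = X - \sum_(1 <= n < N.+1) g n * f n * (w n - S).
  rewrite /T mulr_sumr -sumrB; apply: eq_bigr => n _; ring.
have norm1 (h F : nat -> R) : (forall n, `|h n| <= 1) ->
    `|\sum_(1 <= n < N.+1) h n * F n| <= \sum_(1 <= n < N.+1) `|F n|.
  move=> h1; apply: le_trans (ler_norm_sum _ _ _) _; apply: ler_sum => n _.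
  by rewrite normrM ler_piMl.
have ST : S * `|T| <= `|X + Y| + \sum_(1 <= m < N.+1) `|G m|
                      + \sum_(1 <= n < N.+1) `|w n - S|.
  rewrite -{1}(ger0_norm S0) -normrM TE.
  apply: le_trans (ler_normB _ _) _; apply: lerD; last first.
    apply: (norm1 (fun n => g n * f n)) => n.
    by rewrite normrM -[leRHS]mulr1 ler_pM.
  rewrite -{1}(addrK Y X).
  by apply: le_trans (ler_normB _ _) _; rewrite lerD2l norm1.
have := sum_norm_le_sqr G N t0; have := sum_norm_le_sqr (fun n => w n - S) N t0.
have ti0 : 0 <= t^-1 by rewrite invr_ge0 ltW.
have := ler_wpM2r ti0 G2; have := ler_wpM2r ti0 W2; move: ST XY.
set a := `|X + Y|; set b := \sum_(_ <= _ < _) `|_|; set c := \sum_(_ <= _ < _) `|_|.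
set d := (\sum_(_ <= _ < _) _) / t; set e := (\sum_(_ <= _ < _) _) / t.
by move=> h1 h2 h3 h4 h5 h6; lra.
Qed.

Theorem katai_criterion (R : archiRealFieldType) (f : nat -> R) (M : nat) :
    (forall n, `|f n| <= 1) ->
    (forall p r, prime p -> prime r -> (M < p)%N -> (M < r)%N -> p != r ->
       small_o (prime_correlation f p r)) ->
  small_o (fun N => \sum_(1 <= n < N.+1) (mobius n)%:~R * f n).
Proof.
(* With d = 1 / K, the terms of [katai_inequality] come to at most 2 + 2 + 2 + 2 + 1 = 9 times d N
   S, below the 10 d N S <= 2 S e N that is allowed. *)
move=> f1 fo e e0; pose K := (Num.truncn (5 / e)).+1.
have Kgt0 : 0 < K%:R :> R by rewrite ltr0n.
have K1 : 1 <= K%:R :> R by rewrite ler1n.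
have Ke : 5 * K%:R^-1 <= e.
  rewrite ler_pdivrMr // mulrC -ler_pdivrMr //.
  by rewrite ltW // truncnS_gt // divr_ge0 // ltW.
set d := K%:R^-1 in Ke; have d0 : 0 < d by rewrite invr_gt0.
have dK : d * K%:R = 1 by rewrite mulVf // gt_eqF.
(* Primes above 2 K bring 4 N / M' down to 2 d N, and S >= K^2 gives 2 K N <= 2 d N S for t = K. *)
pose M' := maxn M (2 * K).
have [s [us sP sB]] := sum_inv_primes_unbounded R M' (K ^ 2).
have sP' p : p \in s -> prime p /\ (M < p)%N.
  by move=> /sP/andP[-> Mp]; split=> //; apply: leq_ltn_trans Mp; rewrite leq_maxl.
have Off_o : small_o (fun N => \sum_(p <- s) \sum_(r <- s | r != p)
    prime_correlation f p r (N %/ maxn p r)).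
  apply: small_o_sum => p /sP'[p_pr Mp] _; apply: small_o_sum => r /sP'[r_pr Mr] rp.
  apply: small_o_divn; first by rewrite leq_max prime_gt0.
  by apply: fo; rewrite // eq_sym.
have [N0 HN0] := Off_o _ d0.
exists (maxn N0 (size s * K)) => N; rewrite geq_max => /andP[/HN0 {HN0} HN0 sN].
have M'0 : (0 < M')%N by rewrite leq_max muln_gt0 orbT.
have gM p m : p \in s -> (0 < m)%N -> ~~ (p %| m)%N ->
    (mobius (p * m))%:~R = - (mobius m)%:~R :> R.
  by move=> /sP'[p_pr _] m0 pm; rewrite mobius_prime_mul // rmorphN.
have := katai_inequality N f1 (mobius_norm_le1 R) gM us sP M'0 Kgt0.
move: HN0; set Off := \sum_(p <- s) _; set T := \sum_(_ <= _ < _) _.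
move: sB; set S := \sum_(p <- s) _ => sB HOff.
have KS : K%:R * K%:R <= S by rewrite -natrM mulnn.
have S1 : 1 <= S by nra.
have sN' : (size s)%:R <= d * N%:R.
  by rewrite mulrC ler_pdivlMr // -natrM ler_nat.
have M'd : N%:R / M'%:R <= N%:R * d / 2.
  rewrite -mulrA ler_wpM2l // -invfM lef_pV2 ?posrE ?mulr_gt0 ?ltr0n //.
    by rewrite -natrM ler_nat mulnC leq_maxr.
have N0' : 0 <= N%:R :> R by [].
have Offd : Off / K%:R <= d * N%:R.
  rewrite ler_pdivrMr //; apply: le_trans (ler_norm _) (le_trans HOff _).
  by rewrite ler_peMr // mulr_ge0 // ltW.
have sd : (size s)%:R * d <= d * N%:R.
  by apply: le_trans sN'; rewrite ler_piMr // invf_le1.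
have tN : K%:R * N%:R <= S * (d * N%:R).
  rewrite mulrA ler_wpM2r // mulrC -[leRHS]mulr1.
  have : K%:R * K%:R * d <= S * d by rewrite ler_pM2r.
  by rewrite -mulrA [K%:R * d]mulrC dK mulr1; lra.
move=> main; suff : 2 * S * `|T| <= 2 * S * (e * N%:R).
  by rewrite ler_pM2l // mulr_gt0 //; lra.
apply: le_trans main _.
have e5 : S * (5 * d * N%:R) <= S * (e * N%:R).
  by rewrite ler_wpM2l ?ler_wpM2r //; lra.
have := ler_wpM2l (le_trans ler01 S1) sd.
have := ler_wpM2l (le_trans ler01 S1) M'd.
have dN0 : 0 <= d * N%:R by rewrite mulr_ge0 // ltW.
have : d * N%:R <= S * (d * N%:R) by rewrite ler_peMl.
have : 0 <= S * (d * N%:R) by rewrite mulr_ge0 //; lra.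
move: Offd tN e5; rewrite -/d; set x := K%:R; set y := M'%:R^-1.
by lra.
Qed.

(** * Correlations of digital products *)

Lemma big_nat_mul_block (T : Type) (idx : T) (op : Monoid.com_law idx) (A B : nat)
    (F : nat -> T) :
  \big[op/idx]_(0 <= n < A * B) F n
    = \big[op/idx]_(0 <= x < A) \big[op/idx]_(0 <= s < B) F (s + B * x)%N.
Proof.
elim: A => [|A IHA]; first by rewrite mul0n !big_geq.
rewrite big_nat_recr //= -IHA (@big_cat_nat _ _ _ (A * B)) //=; last by lia.
congr (op _ _); rewrite -{1}[(A * B)%N]add0n big_addn mulSn addnK.
by apply: eq_bigr => s _; rewrite mulnC.
Qed.

Lemma norm_sum_le (R : numDomainType) (g : nat -> R) (m n : nat) :
  (forall n, `|g n| <= 1) -> `|\sum_(m <= i < n) g i| <= (n - m)%:R.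
Proof.
move=> g1; apply: le_trans (ler_norm_sum _ _ _) _.
by rewrite -sumr_const_nat; apply: ler_sum.
Qed.

(* The top base-B digit of s + B^j.+1 * m below B^j.+1 is either outside {u, v},
   or can be swapped between u and v. *)
Lemma block_cancellation (R : realDomainType) (g : nat -> R) (B u v : nat) :
    (u < B)%N -> (v < B)%N -> u != v -> (forall n, `|g n| <= 1) ->
    (forall j s m, (s < B ^ j)%N -> (0 < m)%N ->
       g (s + B ^ j * (u + B * m))%N = - g (s + B ^ j * (v + B * m))%N) ->
  forall j m, (0 < m)%N ->
    `|\sum_(0 <= s < B ^ j) g (s + B ^ j * m)%N| <= ((B - 2) ^ j)%:R.
Proof.
move=> uB vB uv g1 flip; elim=> [|j IHj] m m0.
  by rewrite !expn0 big_nat1.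
rewrite expnS big_nat_mul_block.
(* [G x] collects the numbers whose digit above s is x. [G u] and [G v] cancel; each of the other B
   - 2 digits joins the prefix, which stays positive, and the induction hypothesis applies. *)
pose G x := \sum_(0 <= s < B ^ j) g (s + B ^ j * (x + B * m))%N.
have -> : \sum_(0 <= x < B) \sum_(0 <= s < B ^ j) g (s + B ^ j * x + B * B ^ j * m)%N
    = \sum_(x < B) G x.
  rewrite big_mkord; apply: eq_bigr => x _; apply: eq_bigr => s _; congr g; ring.
pose u' := Ordinal uB; pose v' := Ordinal vB.
have vu : v' != u' by rewrite eq_sym.
rewrite (bigD1 u') //= (bigD1 v') //= addrA.
have -> : G u + G v = 0.
  rewrite /G -big_split /= big_nat big1 // => s /andP[_ sj].
  by rewrite flip // addNr.
rewrite add0r; apply: le_trans (ler_norm_sum _ _ _) _.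
apply: (@le_trans _ _ (\sum_(x < B | (x != u') && (x != v')) ((B - 2) ^ j)%:R)).
  apply: ler_sum => x _; apply: IHj.
  by rewrite addn_gt0 muln_gt0 m0 (leq_ltn_trans _ uB) ?orbT.
rewrite sumr_const -mulrnA expnS mulnC.
suff -> : #|[pred x | (x != u') && (x != v')]| = (B - 2)%N by [].
have := cardC (pred2 u' v'); rewrite card2 card_ord eq_sym vu.
rewrite (@eq_card _ (predC (pred2 u' v')) [pred x | (x != u') && (x != v')]) /=.
  by move/(canRL (addKn 2)).
by move=> x; rewrite !inE negb_or.
Qed.

(** Bernoulli's inequality (1 + 1/a)^j >= 1 + j/a, cleared of denominators. *)
Lemma expn_bernoulli (a j : nat) : (a ^ j * (a + j) <= a * a.+1 ^ j)%N.
Proof.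
elim: j => [|j IHj]; first by rewrite !expn0 mul1n addn0 muln1.
rewrite !expnS; move: IHj; set x := (a ^ j)%N; set y := (a.+1 ^ j)%N => IHj.
have := leq_mul (leqnn a.+1) IHj; nia.
Qed.

Lemma expn_ratio_small (R : archiRealFieldType) (a b : nat) (e : R) :
  (a < b)%N -> 0 < e -> exists j, (a ^ j)%:R <= e * (b ^ j)%:R.
Proof.
move=> ab e0; pose j := (Num.truncn (a%:R / e)).+1; exists j.
have je : a%:R <= e * j%:R.
  rewrite mulrC -ler_pdivrMr // ltW // truncnS_gt // divr_ge0 // ltW //.
have aj : 0 < (a + j)%:R :> R by rewrite ltr0n addnS.
rewrite -(ler_pM2r aj) -natrM.
apply: (@le_trans _ _ (a * b ^ j)%:R).
  rewrite ler_nat; apply: leq_trans (expn_bernoulli _ _) _.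
  by rewrite leq_mul2l leq_exp2r ?ab ?orbT.
rewrite natrM mulrAC ler_wpM2r // natrD mulrDr.
by apply: le_trans je _; rewrite lerDr mulr_ge0 // ltW.
Qed.

(** Take j with ((B-2)/B)^j <= e/2 and cut [0, N] into intervals of length C = B^j. Only the first
    one, whose prefix m = 0 admits no flip, and the incomplete last one are bounded trivially. *)
Lemma small_o_block_cancellation (R : archiRealFieldType) (g : nat -> R)
    (B u v : nat) :
    (u < B)%N -> (v < B)%N -> u != v -> (forall n, `|g n| <= 1) ->
    (forall j s m, (s < B ^ j)%N -> (0 < m)%N ->
       g (s + B ^ j * (u + B * m))%N = - g (s + B ^ j * (v + B * m))%N) ->
  small_o (fun N => \sum_(1 <= n < N.+1) g n).
Proof.
move=> uB vB uv g1 flip e e0; have e20 : 0 < e / 2 by rewrite divr_gt0.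
have [|j hj] := @expn_ratio_small R (B - 2) B _ _ e20; first by lia.
have blockj := block_cancellation uB vB uv g1 flip j.
set C := (B ^ j)%N in hj blockj.
have C0 : (0 < C)%N by rewrite expn_gt0; apply/orP; left; lia.
have full Q : `|\sum_(0 <= n < Q * C) g n| <= C%:R + Q%:R * (e / 2 * C%:R).
  rewrite big_nat_mul_block; apply: le_trans (ler_norm_sum _ _ _) _.
  case: Q => [|Q]; first by rewrite big_geq // mul0r addr0.
  rewrite big_nat_recl // lerD //.
    by apply: le_trans (norm_sum_le _ _ _) _; rewrite ?subn0.
  apply: (@le_trans _ _ (Q%:R * (e / 2 * C%:R))); last first.
    by rewrite ler_wpM2r ?ler_nat // mulr_ge0 // ltW.
  rewrite mulr_natl -[Q in leRHS]subn0 -sumr_const_nat; apply: ler_sum => x _.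
  exact: le_trans (blockj _ _) hj.
(* The two trivial intervals and [g 0] cost at most C + C + 1 <= 4 C, to be covered by e N / 2. *)
pose N0 := (Num.truncn (2 * (4 * C)%:R / e)).+1.
exists N0 => N N0N.
have -> : \sum_(1 <= n < N.+1) g n = \sum_(0 <= n < N.+1) g n - g 0%N.
  by rewrite [in RHS]big_nat_recl // addrC addKr big_add1.
have bigN : (4 * C)%:R <= e / 2 * N%:R.
  have : 2 * (4 * C)%:R / e <= N%:R.
    apply: le_trans (_ : N0%:R <= _); last by rewrite ler_nat.
    by rewrite ltW // truncnS_gt // divr_ge0 // ?mulr_ge0 // ltW.
  rewrite ler_pdivrMr //; lra.
pose Q := (N %/ C)%N; pose t := (N %% C)%N.
have NE : N = (Q * C + t)%N by exact: divn_eq.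
have tC : (t < C)%N by rewrite ltn_mod.
rewrite (@big_cat_nat _ _ _ (Q * C)) //=; last by rewrite NE; lia.
have := full Q; have := norm_sum_le (Q * C)%N N.+1 g1; have := g1 0%N.
have -> : (N.+1 - Q * C = t.+1)%N by rewrite NE; lia.
set a := \sum_(_ <= _ < _) _; set b := \sum_(_ <= _ < _) _ => h1 h2 h3.
have tC' : t.+1%:R + 1 <= C%:R + 1 :> R by rewrite lerD2r ler_nat.
have C2 : 1 + C%:R + C%:R + 1 <= (4 * C)%:R :> R.
  by rewrite natrM; have : 1 <= C%:R :> R; [rewrite ler1n | lra].
have QN : Q%:R * C%:R <= N%:R :> R by rewrite -natrM ler_nat leq_trunc_div.
have eQN := ler_wpM2l (ltW e20) QN.
apply: le_trans (ler_normB _ _) _; apply: le_trans (lerD (ler_normD _ _) (lexx _)) _.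
move: tC' bigN C2 eQN; lra.
Qed.

(** * Products over windows of digits *)

(** For [w] of period q^(k+1), factor i reads the digits i, ..., i + k of n. *)
Definition window_prod (R : pzSemiRingType) (w : nat -> R) (q K n : nat) : R :=
  \prod_(i < K) w (n %/ q ^ i)%N.

Lemma window_prodD (R : comPzRingType) (w : nat -> R) (q J K n : nat) :
  window_prod w q (J + K) n = window_prod w q J n * window_prod w q K (n %/ q ^ J).
Proof.
rewrite /window_prod big_split_ord /=; congr (_ * _).
by apply: eq_bigr => i _; rewrite -divnMA expnD.
Qed.

Lemma window_prod_sqr (R : comPzRingType) (w : nat -> R) (q K n : nat) :
  (forall n, w n ^+ 2 = 1) -> window_prod w q K n ^+ 2 = 1.
Proof. by move=> w2; rewrite /window_prod -prodrXl big1. Qed.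

Lemma window_prod_period (R : comPzRingType) (w : nat -> R) (q k J n m : nat) :
    (0 < q)%N -> (forall n m, w (n + q ^ k.+1 * m)%N = w n) ->
  window_prod w q J (n + q ^ (J + k) * m) = window_prod w q J n.
Proof.
move=> q0 wper; apply: eq_bigr => i _.
have -> : (q ^ (J + k) * m = q ^ i * (q ^ k.+1 * (q ^ (J - i.+1) * m)))%N.
  rewrite !mulnA -!expnD; congr (_ ^ _ * _)%N; have := ltn_ord i; lia.
by rewrite [(q ^ i * _)%N]mulnC divnDMl ?expn_gt0 ?q0 // wper.
Qed.

(** Windows starting below J see nothing of m; those starting from J on see nothing of a. *)
Lemma window_prod_split (R : comPzRingType) (w : nat -> R) (q k J K a b m : nat) :
    (0 < q)%N -> (forall n m, w (n + q ^ k.+1 * m)%N = w n) -> (a < q ^ J)%N ->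
  window_prod w q (J + K) (a + q ^ J * (b + q ^ k * m))
    = window_prod w q J (a + q ^ J * b) * window_prod w q K (b + q ^ k * m).
Proof.
move=> q0 wper aJ; rewrite window_prodD; congr (_ * window_prod _ _ _ _).
  by rewrite mulnDr addnA mulnA -expnD window_prod_period.
by rewrite addnC mulnC divnMDl ?expn_gt0 ?q0 // divn_small // addn0.
Qed.

(** Equals (-1)^a(n) for [w] = (-1)^P; the truncated subtraction gives the empty product 1 when
    T_q(n) < k. *)
Definition digital_prod (R : pzSemiRingType) (w : nat -> R) (q k n : nat) : R :=
  window_prod w q ((topdigit q n).+1 - k) n.

(** With k zeros between a and m, no window of k + 1 digits meets both. *)
Lemma digital_prod_split (R : comPzRingType) (w : nat -> R) (q k K a m : nat) :
    (1 < q)%N -> (forall n m, w (n + q ^ k.+1 * m)%N = w n) ->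
    (a < q ^ K)%N -> (0 < m)%N ->
  digital_prod w q k (a + q ^ (K + k) * m)
    = window_prod w q K a * window_prod w q (topdigit q m).+1 (q ^ k * m).
Proof.
move=> q1 wper aK m0; have q0 := ltnW q1.
have -> : (q ^ (K + k) * m = q ^ K * (0 + q ^ k * m))%N by rewrite add0n mulnA expnD.
rewrite /digital_prod.
(* The top digit lies at K + k + T_q(m), so the number of windows exceeds K by T_q(m) + 1. *)
have -> : ((topdigit q (a + q ^ K * (0 + q ^ k * m))).+1 - k
           = K + (topdigit q m).+1)%N.
  have /andP[lo hi] := trunc_log_bounds q1 m0.
  rewrite /topdigit add0n mulnA -expnD (@trunc_log_eq _ (K + k + trunc_log q m)) //.
    by rewrite -addnS -addnA addnCA addKn.
  rewrite -[(K + k + _).+1%N]addnS !(expnD q (K + k)).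
  have : (q ^ (K + k) * m.+1 <= q ^ (K + k) * q ^ (trunc_log q m).+1)%N.
    by rewrite leq_mul2l hi orbT.
  have : (q ^ (K + k) * q ^ trunc_log q m <= q ^ (K + k) * m)%N.
    by rewrite leq_mul2l lo orbT.
  have : (q ^ K <= q ^ (K + k))%N by rewrite leq_exp2l // leq_addr.
  move: aK; rewrite mulnS; set X := (q ^ (K + k))%N; clearbody X.
  set Y := (X * m)%N; set Z := (X * _)%N; set V := (X * _)%N; clearbody Y Z V; lia.
by rewrite window_prod_split // muln0 addn0 add0n.
Qed.

(** As p <= q^z, the product p s fits in z + l digits. Above it come k zeros, p u, at least k zeros
    and p m, so that each window meets at most one of the three and u affects only the middle
    factor. *)
Lemma digital_prod_block (R : comPzRingType) (w : nat -> R)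
    (q k z K l p u s m : nat) :
    (1 < q)%N -> (forall n m, w (n + q ^ k.+1 * m)%N = w n) ->
    (0 < p)%N -> (p <= q ^ z)%N -> (s < q ^ l)%N -> (0 < m)%N ->
    (q ^ k * (p * u) < q ^ K)%N ->
  digital_prod w q k (p * (s + q ^ l * (q ^ (z + k) * u + q ^ (z + k + K) * m)))
    = window_prod w q (z + l) (p * s) * window_prod w q K (q ^ k * (p * u))
      * window_prod w q (topdigit q (p * m)).+1 (q ^ k * (p * m)).
Proof.
move=> q1 wper p0 pz sl m0 uK; have q0 := ltnW q1.
have psl : (p * s < q ^ (z + l))%N.
  rewrite expnD; apply: (@leq_ltn_trans (q ^ z * s)).
    by rewrite leq_mul2r pz orbT.
  by rewrite ltn_pmul2l // expn_gt0 q0.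
pose J := (z + l)%N.
have -> : (p * (s + q ^ l * (q ^ (z + k) * u + q ^ (z + k + K) * m))
   = (p * s + q ^ J * (0 + q ^ k * (p * u))) + q ^ (J + K + k) * (p * m))%N.
  by rewrite /J !expnD; ring.
rewrite digital_prod_split ?muln_gt0 ?p0 //.
  by rewrite window_prod_split // muln0 addn0 add0n.
rewrite expnD add0n; apply: (@leq_trans (q ^ J * (q ^ k * (p * u)).+1)).
  by rewrite mulnS ltn_add2r.
by rewrite leq_mul2l uK orbT.
Qed.

(** * Blocks whose exchange flips the sign *)

(* x + 1 is the least multiplier for which r * (x + 1) reaches C.+1 * q ^ j; as
   p * C.+1 / r is not an integer, p * x and p * x.+1 stay on the same side of every
   multiple of q ^ j as soon as q ^ j > p * r. *)
Lemma exists_separating_step (q p r C : nat) :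
    (1 < q)%N -> (0 < p)%N -> (0 < r)%N -> ~~ (r %| p * C.+1)%N ->
  exists j x, [/\ (r * x %/ q ^ j = C)%N, (r * x.+1 %/ q ^ j = C.+1)%N
                & (p * x.+1 %/ q ^ j = p * x %/ q ^ j)%N].
Proof.
move=> q1 p0 r0 rpC; pose j := (p * r)%N; pose A := (q ^ j)%N.
have A0 : (0 < A)%N by rewrite expn_gt0 ltnW.
have prA : (p * r < A)%N by exact: ltn_expl.
have rA : (r < A)%N by apply: leq_ltn_trans prA; rewrite leq_pmull.
pose x := ((C.+1 * A).-1 %/ r)%N.
have lo : (r * x < C.+1 * A)%N.
  have : (x * r <= (C.+1 * A).-1)%N by exact: leq_trunc_div.
  by rewrite mulnC; have : (0 < C.+1 * A)%N; [rewrite muln_gt0 A0 | lia].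
have hi : (C.+1 * A <= r * x.+1)%N.
  have : ((C.+1 * A).-1 < x.+1 * r)%N by exact: ltn_ceil.
  by rewrite [(r * _)%N]mulnC; lia.
exists j, x; rewrite -/A; split.
- apply/eqP; rewrite eqn_leq -ltnS ltn_divLR // lo leq_divRL //=.
  by move: hi; rewrite mulnS mulSn; lia.
- apply/eqP; rewrite eqn_leq -ltnS ltn_divLR // leq_divRL // hi andbT.
  by move: lo; rewrite mulnS !mulSn; lia.
apply/eqP; rewrite eqn_leq; apply/andP; split; last first.
  by rewrite leq_div2r // leq_mul2l leqnSn orbT.
rewrite leqNgt; apply/negP; set M := (p * x.+1 %/ A)%N; rewrite ltn_divLR // => pxM.
have Mpx : (M * A <= p * x.+1)%N by exact: leq_trunc_div.
(* Here M q^j lies in (p x, p (x+1)], so r M q^j and p (C+1) q^j both lie in (p r x, p r x + p r],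
   which is shorter than q^j; hence they are equal. *)
case/negP: rpC; suff -> : (p * C.+1 = r * M)%N by rewrite dvdn_mulr.
have a1 : (r * (p * x) < r * (M * A))%N by rewrite ltn_pmul2l.
have a2 : (r * (M * A) <= r * (p * x.+1))%N by rewrite leq_pmul2l.
have a3 : (p * (r * x) < p * (C.+1 * A))%N by rewrite ltn_pmul2l.
have a4 : (p * (C.+1 * A) <= p * (r * x.+1))%N by rewrite leq_pmul2l.
have Z : (r * (p * x.+1) = r * (p * x) + p * r)%N by ring.
have Z' : (p * (r * x.+1) = r * (p * x) + p * r)%N by ring.
have Z'' : (p * (r * x) = r * (p * x))%N by ring.
rewrite Z in a2; rewrite Z' in a4; rewrite Z'' in a3.
have b1 : (p * C.+1 * A < (r * M).+1 * A)%N by rewrite [(_.+1 * A)%N]mulSn -!mulnA; lia.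
have b2 : (r * M * A < (p * C.+1).+1 * A)%N by rewrite [(_.+1 * A)%N]mulSn -!mulnA; lia.
move: b1 b2; rewrite !ltn_pmul2r //; lia.
Qed.

(** Four equal signs would have product 1. *)
Lemma exists_opposite_sign (R : realDomainType) (h : bool -> bool -> R) :
    (forall s t, h s t ^+ 2 = 1) ->
    h false false * h true false * h false true * h true true = -1 ->
  exists s t, h s t = - h false false.
Proof.
move=> h2 hprod.
have sgn s t : h s t = h false false \/ h s t = - h false false.
  have : h s t ^+ 2 == h false false ^+ 2 by rewrite !h2.
  by rewrite eqf_sqr => /orP[/eqP|/eqP]; [left | right].
have [e10|] := sgn true false; last by exists true, false.
have [e01|] := sgn false true; last by exists false, true.
have [e11|] := sgn true true; last by exists true, true.
move: hprod; rewrite e10 e01 e11 -expr2 -mulrA -expr2 !h2 mulr1 => /eqP.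
by rewrite eq_sym lt_eqF // (lt_trans (ltrN10 R) ltr01).
Qed.

(** The test numbers [n s t] make every window of p n and r n depend on at most one of s and t,
    apart from one window of r n, which reads C + s + q^k t. The hypothesis on four values of [w]
    then prevents the four signs from agreeing. *)
Lemma exists_sign_flip (R : realDomainType) (w : nat -> R) (q k p r C : nat) :
    (1 < q)%N -> (0 < k)%N ->
    (forall n m, w (n + q ^ k.+1 * m)%N = w n) -> (forall n, w n ^+ 2 = 1) ->
    (q %| C)%N -> (C.+1 < q ^ k)%N ->
    w C * w C.+1 * w (C + q ^ k)%N * w (C.+1 + q ^ k)%N = -1 ->
    prime p -> prime r -> p != r -> (q ^ k < r)%N ->
  exists K u v, [/\ (forall x, x \in [:: u; v] ->
        (q ^ k * (p * x) < q ^ K)%N && (q ^ k * (r * x) < q ^ K)%N)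
    & window_prod w q K (q ^ k * (p * u)) * window_prod w q K (q ^ k * (r * u))
      = - (window_prod w q K (q ^ k * (p * v)) * window_prod w q K (q ^ k * (r * v)))].
Proof.
move=> q1 k0 wper w2 qC CK wC p_pr r_pr pr qr.
have q0 := ltnW q1; have p0 := prime_gt0 p_pr; have r0 := prime_gt0 r_pr.
have qk0 : (0 < q ^ k)%N by rewrite expn_gt0 q0.
have qle : (q <= q ^ k)%N by rewrite -{1}(expn1 q) leq_exp2l.
(* r > q^k > C + 1 cannot divide p (C + 1), p being another prime. *)
have [|j [x [rx rx1 px]]] := exists_separating_step (C := C) q1 p0 r0.
  rewrite Euclid_dvdM // dvdn_prime2 // eq_sym (negPf pr) /=.
  by apply/negP => /dvdn_leq; lia.
(* r y ends in the digit 1, so that t appears as the digit of r n at position j + k. *)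
have [y [e ye]] : exists y e, (r * y = 1 + q * e)%N.
  have : coprime r q.
    by rewrite prime_coprime //; apply/negP => /dvdn_leq; lia.
  case/(coprimeP _ r0) => -[y e] /= h; exists y, e; lia.
pose n (s t : bool) := (x + s + q ^ (j + k) * (t * y))%N.
(* Large enough that q^L exceeds q^k p n and q^k r n for all four n. *)
pose L := (q ^ k * ((p + r) * n true true))%N.
pose K := (j + k + (1 + L))%N.
pose H n := window_prod w q K (q ^ k * (p * n)) * window_prod w q K (q ^ k * (r * n)).
have nmono s t : (n s t <= n true true)%N.
  rewrite /n leq_add // ?leq_add2l; first by case: s.
  by rewrite leq_mul2l leq_mul2r; case: t; rewrite ?orbT.
have bound a s t : (a <= p + r)%N -> (q ^ k * (a * n s t) < q ^ K)%N.
  move=> apr; apply: leq_ltn_trans (_ : L < _)%N.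
    by rewrite leq_mul2l leq_mul ?orbT.
  apply: ltn_trans (ltn_expl L q1) _.
  by rewrite ltn_exp2l // /K add1n addnS ltnS leq_addl.
(* In q^k a n, the first j + k windows do not reach t: they see only digits of a (x + s). The others
   see only F and t. *)
have decomp a (s t : bool) (F : nat) : (a * (x + s) %/ q ^ j = F)%N ->
    window_prod w q K (q ^ k * (a * n s t))
    = window_prod w q (j + k)
        (q ^ k * (a * (x + s) %% q ^ j) + q ^ (j + k) * F)
      * window_prod w q (1 + L) (F + q ^ k * (t * (a * y))).
  move=> FE; rewrite -(window_prod_split (k := k)) //; last first.
    by rewrite [(j + k)%N]addnC expnD ltn_pmul2l // ltn_mod expn_gt0 q0.
  congr window_prod; rewrite /n mulnDr {1}(divn_eq (a * (x + s)) (q ^ j)) FE !expnD.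
  ring.
(* Detaches the window at position j, the only one of r n where s and t meet: the later ones read C
   / q, free of s. *)
have firstw F m : window_prod w q (1 + L) (F + q ^ k * m)
    = w (F + q ^ k * m)%N * window_prod w q L (F %/ q + q ^ k.-1 * m).
  rewrite window_prodD /window_prod big_ord1 expn0 divn1 expn1.
  by rewrite -{2}(prednK k0) expnSr -mulnA [(q * m)%N]mulnC mulnA divnDMl.
have [A [B HE]] : exists (A B : bool -> R), forall s t : bool,
    [/\ A s ^+ 2 = 1, B t ^+ 2 = 1
      & H (n s t) = A s * B t * w (C + s + q ^ k * t)%N].
  pose F := (p * x %/ q ^ j)%N.
  exists (fun s => window_prod w q (j + k)
        (q ^ k * (p * (x + s) %% q ^ j) + q ^ (j + k) * F)
      * window_prod w q (j + k)
        (q ^ k * (r * (x + s) %% q ^ j) + q ^ (j + k) * (C + s))).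
  exists (fun t : bool => window_prod w q (1 + L) (F + q ^ k * (t * (p * y)))
      * window_prod w q L (C %/ q + q ^ k.-1 * (t * (r * y)))).
  move=> s t; rewrite !exprMn !window_prod_sqr // mulr1; split=> //.
  rewrite /H (@decomp p s t F); last by case: s; rewrite ?addn1 ?addn0.
  rewrite (@decomp r s t (C + s)%N); last first.
    by case: s; rewrite ?addn1 ?addn0.
  rewrite [window_prod w q (1 + L) (C + s + _)]firstw.
  have -> : ((C + s) %/ q = C %/ q)%N.
    by rewrite divnDl // (@divn_small s) ?addn0 //; case: (s) => //; exact: ltnW.
  (* Modulo q^(k+1) only the last digit of t r y counts, and it is t. *)
  have -> : w (C + s + q ^ k * (t * (r * y)))%N = w (C + s + q ^ k * t)%N.
    rewrite ye -[RHS](wper _ (t * e)%N) expnSr; congr w; ring.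
  ring.
have H2 m : H m ^+ 2 = 1 by rewrite exprMn !window_prod_sqr // mulr1.
have [||s [t hst]] := @exists_opposite_sign R (fun s t => H (n s t)).
- by move=> s t.
- have [A0 B0 ->] := HE false false; have [A1 B1 ->] := HE true true.
  have [_ _ ->] := HE false true; have [_ _ ->] := HE true false.
  rewrite !muln0 !muln1 !addn0 !addn1 -wC.
  transitivity (A false ^+ 2 * B false ^+ 2 * (A true ^+ 2 * B true ^+ 2)
      * (w C * w C.+1 * w (C + q ^ k)%N * w (C.+1 + q ^ k)%N)); first by ring.
  by rewrite A0 B0 A1 B1 !mulr1 mul1r.
exists K, (n s t), (n false false); split; last exact: hst.
by move=> z; rewrite !inE => /orP[/eqP->|/eqP->]; rewrite !bound ?leq_addl ?leq_addr.
Qed.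

(** Blocks u and v, padded below by z + k zeros, affect only the middle factors given by
    [digital_prod_block] for p and for r. Exchanging them flips the sign, and the block cancellation
    applies in base q^D. *)
Lemma digital_prod_correlation (R : archiRealFieldType) (w : nat -> R)
    (q k p r C : nat) :
    (1 < q)%N -> (0 < k)%N ->
    (forall n m, w (n + q ^ k.+1 * m)%N = w n) -> (forall n, w n ^+ 2 = 1) ->
    (q %| C)%N -> (C.+1 < q ^ k)%N ->
    w C * w C.+1 * w (C + q ^ k)%N * w (C.+1 + q ^ k)%N = -1 ->
    prime p -> prime r -> p != r -> (q ^ k < r)%N ->
  small_o (prime_correlation (digital_prod w q k) p r).
Proof.
move=> q1 k0 wper w2 qC CK wC p_pr r_pr pr qr.
have q0 := ltnW q1; have p0 := prime_gt0 p_pr; have r0 := prime_gt0 r_pr.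
have [K [u [v [uvK flip]]]] :=
  exists_sign_flip q1 k0 wper w2 qC CK wC p_pr r_pr pr qr.
have /andP[puK ruK] := uvK u (mem_head _ _).
have /andP[pvK rvK] : (q ^ k * (p * v) < q ^ K)%N && (q ^ k * (r * v) < q ^ K)%N.
  by apply: uvK; rewrite !inE eqxx orbT.
have f2 n : digital_prod w q k n ^+ 2 = 1 by exact: window_prod_sqr.
pose z := (p + r)%N; pose D := (z + k + K)%N.
have pz : (p <= q ^ z)%N.
  by apply: ltnW; apply: leq_ltn_trans (ltn_expl z q1); rewrite leq_addr.
have rz : (r <= q ^ z)%N.
  by apply: ltnW; apply: leq_ltn_trans (ltn_expl z q1); rewrite leq_addl.
have small x : (q ^ k * (p * x) < q ^ K)%N -> (q ^ (z + k) * x < q ^ D)%N.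
  move=> xK; rewrite /D -addnA [in ltnRHS]expnD expnD -mulnA.
  rewrite ltn_pmul2l ?expn_gt0 ?q0 //.
  apply: leq_trans (_ : q ^ K <= _)%N; last by rewrite leq_exp2l // leq_addl.
  by apply: leq_ltn_trans xK; rewrite leq_mul2l leq_pmull // orbT.
apply: (@small_o_block_cancellation R
  (fun m => digital_prod w q k (p * m) * digital_prod w q k (r * m))
  (q ^ D) (q ^ (z + k) * u) (q ^ (z + k) * v)); rewrite ?small //.
- rewrite eqn_pmul2l ?expn_gt0 ?q0 //; apply/eqP => uv.
  move: flip; rewrite uv => /eqP; rewrite -subr_eq0 opprK -mulr2n mulrn_eq0 /=.
  by rewrite -sqrf_eq0 exprMn !window_prod_sqr // mulr1 oner_eq0.
- move=> n; rewrite -(@expr_le1 _ 2) // -normrX exprMn !f2 mulr1 normr1 //.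
move=> j s m sj m0; rewrite -!expnM in sj *.
have regroup (a x b c y d : R) : a * x * b * (c * y * d) = a * b * c * d * (x * y).
  ring.
by rewrite !digital_prod_block // !regroup flip mulrN.
Qed.

Lemma sum_digits_lt (q n : nat) (c : nat -> nat) : (forall i, (c i < q)%N) ->
  (\sum_(i < n) c i * q ^ i < q ^ n)%N.
Proof.
move=> cq; elim: n => [|n IHn]; first by rewrite big_ord0 expn0.
rewrite big_ord_recr /= expnS.
apply: (@leq_trans ((c n).+1 * q ^ n)); first by rewrite mulSn ltn_add2r.
by rewrite leq_mul2r cq orbT.
Qed.

Lemma digit_sum_digits (q n j : nat) (c : nat -> nat) : (forall i, (c i < q)%N) ->
  (j < n)%N -> digit q j (\sum_(i < n) c i * q ^ i) = c j.
Proof.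
move=> cq jn; have q0 : (0 < q)%N by apply: leq_ltn_trans (cq 0%N).
rewrite /digit -(big_mkord xpredT (fun i => c i * q ^ i)%N).
rewrite (@big_cat_nat _ _ _ j) //= ?(ltnW jn) // [X in (_ + X)%N]big_ltn // big_mkord.
have -> : (\sum_(j.+1 <= i < n) c i * q ^ i
           = q * (\sum_(j.+1 <= i < n) c i * q ^ (i - j.+1)) * q ^ j)%N.
  rewrite -mulnA mulnC -mulnA mulnC -expnSr mulnC big_distrl /= big_nat [RHS]big_nat.
  by apply: eq_bigr => i /andP[ji _]; rewrite -mulnA -expnD subnK.
rewrite addnC -mulnDl divnMDl ?expn_gt0 ?q0 // divn_small ?sum_digits_lt // addn0.
by rewrite addnC mulnC modnMDl modn_small.
Qed.

Lemma digit_period (q k j n m : nat) : (0 < q)%N -> (j < k)%N ->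
  digit q j (n + q ^ k * m) = digit q j n.
Proof.
move=> q0 jk; rewrite /digit.
have -> : (q ^ k * m = (q * (q ^ (k - j.+1) * m)) * q ^ j)%N.
  by rewrite -{1}(subnK jk) expnD expnS; ring.
by rewrite divnDMl ?expn_gt0 ?q0 // addnC mulnC modnMDl.
Qed.

Lemma signz_sqr (R : numFieldType) (a : int) : ((-1 : R) ^ a) ^+ 2 = 1.
Proof.
rewrite expr2 -expfzMl ?oppr_eq0 ?oner_eq0 //.
by rewrite mulrNN mulr1 exp1rz.
Qed.

Lemma digital_prod_block_sum (R : numFieldType) (q k : nat) (P : mpoly k.+1 int)
    (n : nat) :
  digital_prod (fun n => (-1 : R) ^ meval (fun j : 'I_k.+1 => (digit q j n)%:Z) P) q k n
    = (-1) ^ block_sum q P n.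
Proof.
rewrite /digital_prod /window_prod /block_sum.
rewrite (big_morph (fun a => (-1 : R) ^ a) (id1 := 1) (op1 := *%R)) //; last first.
  by move=> a b; rewrite expfzDr // oppr_eq0 oner_eq0.
apply: eq_bigr => i _; congr (_ ^ _); apply: meval_eq => j.
by rewrite /digit -divnMA -expnD.
Qed.

Definition with_ends (T : Type) (k : nat) (c : nat -> T) (a b : T) (j : nat) : T :=
  if j == 0%N then a else if j == k then b else c j.

Lemma meval_second_difference (k : nat) (P2 : mpoly k.+1 int) (c : nat -> nat) :
    (0 < k)%N ->
    (forall m : multinom k.+1, m \in msupp P2 ->
        ~~ lem (mnm_add (mnm1 ord_max) (mnm1 ord0)) m) ->
  let v a b := fun j : 'I_k.+1 => (with_ends k c a b j)%:Z in
  meval (v 0%N 0%N) P2 + meval (v 1%N 1%N) P2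
    = meval (v 0%N 1%N) P2 + meval (v 1%N 0%N) P2.
Proof.
move=> k0 hP2 v; rewrite !mevalE -!big_split /= big_seq [RHS]big_seq.
apply: eq_bigr => m /hP2 mP; rewrite -!mulrDr; congr (_ * _).
have /orP[/eqP m0|/eqP mk] : (m ord0 == 0%N) || (m ord_max == 0%N).
  apply: contraR mP; rewrite negb_or -!lt0n => /andP[m0 mk].
  apply/forallP => i; rewrite mnmDE !mnm1E.
  have [<-|] := eqVneq ord_max i.
    by rewrite (_ : (ord0 == _ :> 'I_k.+1) = false) // -val_eqE /= eq_sym gtn_eqF.
  by have [<-|] := eqVneq ord0 i.
- have e a a' b : \prod_i v a b i ^+ m i = \prod_i v a' b i ^+ m i.
    apply: eq_bigr => i _; have [->|i0] := eqVneq i ord0; first by rewrite m0 !expr0.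
    by rewrite /v /with_ends (_ : (i == 0%N :> nat) = false) //; apply/negbTE.
  by rewrite (e 0%N 1%N 0%N) (e 0%N 1%N 1%N) addrC.
- have e a b b' : \prod_i v a b i ^+ m i = \prod_i v a b' i ^+ m i.
    apply: eq_bigr => i _; have [->|ik] := eqVneq i ord_max; first by rewrite mk !expr0.
    by rewrite /v /with_ends (_ : (i == k :> nat) = false) //; apply/negbTE.
  by rewrite (e 0%N 0%N 1%N) (e 1%N 1%N 0%N).
Qed.

Lemma exprz_odd_sign (R : numFieldType) (a b : int) :
  a = b *+ 2 + 1 -> (-1 : R) ^ a = -1.
Proof.
move=> ->; have N10 : (-1 : R) != 0 by rewrite oppr_eq0 oner_eq0.
by rewrite mulr2n !expfzDr // -expr2 signz_sqr mul1r expr1z.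
Qed.

Lemma small_o_cvg (R : realType) (u : nat -> R) :
  small_o u -> (fun N : nat => N%:R^-1 * u N) @ \oo --> (0 : R).
Proof.
move=> uo; apply/cvgrPdist_le => e e0; have [N0 HN0] := uo _ e0.
exists N0 => // N /= /HN0; rewrite sub0r normrN normrM normfV normr_nat.
case: N => [|N] h; first by rewrite invr0 mul0r ltW.
by rewrite ler_pdivrMl ?ltr0n // mulrC.
Qed.

Theorem theorem2 (R : realType) (q k : nat) (hq : (2 <= q)%N) (hk : (1 <= k)%N)
    (P P1 P2 : mpoly k.+1 int)
    (* msize is the total degree plus one *)
    (hdeg : (mpoly.msize P <= (k.+1).+1)%N)
    (hP : P = mpolyX int (mnm1 ord_max)
              * mpolyX int (mnm1 ord0) * P1 + P2)
    (hP1 : exists x : 'I_k.+1 -> 'I_q,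
        [/\ x ord_max = 1%N :> nat, x ord0 = 1%N :> nat
          & meval (fun j => (x j : nat)%:Z) P1 = 1])
    (hP2 : forall m : multinom k.+1, m \in msupp P2 ->
        ~~ lem (mnm_add (mnm1 ord_max) (mnm1 ord0)) m) :
  (fun N : nat => N%:R^-1 *
     \sum_(1 <= n < N.+1) (mobius n)%:~R * (-1 : R) ^ block_sum q P n)
    @ \oo --> (0 : R).
Proof.
apply: small_o_cvg; have q0 := ltnW hq.
have [x [xk x0 P1x]] := hP1.
pose c i : nat := x (inord i).
pose v a b (j : 'I_k.+1) := (with_ends k c a b j)%:Z.
pose w n := (-1 : R) ^ meval (fun j : 'I_k.+1 => (digit q j n)%:Z) P.
pose C := (\sum_(i < k) with_ends k c 0 0 i * q ^ i)%N.
have cq a b : (a < 2)%N -> (b < 2)%N -> forall i, (with_ends k c a b i < q)%N.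
  move=> a2 b2 i; rewrite /with_ends; case: ifP => _; first exact: leq_trans a2 hq.
  by case: ifP => _; [exact: leq_trans b2 hq | exact: ltn_ord].
have CE a b : (C + a + q ^ k * b = \sum_(i < k.+1) with_ends k c a b i * q ^ i)%N.
  rewrite big_ord_recr /= {2}/with_ends eqxx (gtn_eqF hk) [(b * _)%N]mulnC.
  congr (_ + _)%N; rewrite /C; case: (k) hk => // k' _.
  rewrite !big_ord_recl /with_ends /= mul0n expn0 muln1 add0n addnC; congr (_ + _)%N.
  by apply: eq_bigr => i _; rewrite ltn_eqF // /bump /= ltnS.
have Cqk : (C < q ^ k)%N by apply: sum_digits_lt; apply: cq.
have qC : (q %| C)%N.
  apply: dvdn_sum => i _; case: i => -[|i] ik; first by rewrite mul0n.
  by rewrite /= expnS mulnCA dvdn_mulr.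
have C1qk : (C.+1 < q ^ k)%N.
  have : (q %| q ^ k - C)%N by rewrite dvdn_sub // -{1}(expn1 q) dvdn_exp2l.
  by move/dvdn_leq; rewrite subn_gt0 => /(_ Cqk); lia.
have w2 n : w n ^+ 2 = 1 by exact: signz_sqr.
have wper n m : w (n + q ^ k.+1 * m)%N = w n.
  by congr (_ ^ _); apply: meval_eq => j; rewrite digit_period.
have wE a b : (a < 2)%N -> (b < 2)%N ->
    w (C + a + q ^ k * b)%N = (-1) ^ meval (v a b) P.
  move=> a2 b2; rewrite CE; congr (_ ^ _); apply: meval_eq => j.
  by rewrite digit_sum_digits //; apply: cq.
have PE a b : meval (v a b) P = b%:Z * a%:Z * meval (v a b) P1 + meval (v a b) P2.
  rewrite hP mevalD !mevalM !mevalXU /v /with_ends /= eqxx.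
  by rewrite (gtn_eqF hk).
have P1v : meval (v 1%N 1%N) P1 = 1.
  rewrite -P1x; apply: meval_eq => j; rewrite /v /with_ends /c inord_val.
  case: eqP => [j0|_]; first by rewrite (_ : j = ord0) ?x0 //; exact/val_inj.
  by case: eqP => [jk|//]; rewrite (_ : j = ord_max) ?xk //; exact/val_inj.
have wC : w C * w C.+1 * w (C + q ^ k)%N * w (C.+1 + q ^ k)%N = -1.
  have -> : w C = (-1) ^ meval (v 0%N 0%N) P by rewrite -wE // muln0 !addn0.
  have -> : w C.+1 = (-1) ^ meval (v 1%N 0%N) P by rewrite -wE // muln0 addn0 addn1.
  have -> : w (C + q ^ k)%N = (-1) ^ meval (v 0%N 1%N) P by rewrite -wE // muln1 addn0.
  have -> : w (C.+1 + q ^ k)%N = (-1) ^ meval (v 1%N 1%N) P.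
    by rewrite -wE // muln1 addn1.
  have N10 : (-1 : R) != 0 by rewrite oppr_eq0 oner_eq0.
  rewrite -!expfzDr //.
  apply: (@exprz_odd_sign _ _ (meval (v 0%N 1%N) P2 + meval (v 1%N 0%N) P2)).
  have := meval_second_difference c hk hP2; rewrite -/(v _ _) /= => diff.
  by rewrite !PE P1v mulr2n -{1}diff; ring.
have f2 n : digital_prod w q k n ^+ 2 = 1 by exact: window_prod_sqr.
have Mo : small_o (fun N => \sum_(1 <= n < N.+1)
    (mobius n)%:~R * digital_prod w q k n).
  apply: (@katai_criterion R _ (q ^ k)) => [n|p r p_pr r_pr _ qr pr].
    by rewrite -(@expr_le1 _ 2) // -normrX f2 normr1.
  exact: (@digital_prod_correlation R w q k p r C).
move=> e e0; have [N0 HN0] := Mo _ e0; exists N0 => N /HN0.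
by under eq_bigr => n _ do rewrite digital_prod_block_sum.
Qed.
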